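(* Let $x,y\in X$ satisfy $1<\partial(x,y)<k$. Then the vectors $$\widehat{x},\qquad \widehat{y},\qquad B_{xy},\qquad C_{xy}$$ form a basis for $\mathrm{Fix}(x,y)$.
   Context: Let $\mathbb{F}_q$ be a finite field with $q$ elements, let $n,k$ be integers with $n>2k\geq 6$, and let $V$ be an $n$-dimensional vector space over $\mathbb{F}_q$. For $m\in\mathbb{Z}$ write $[m]=(q^m-1)/(q-1)$. Let $P$ be the set of all subspaces of $V$ and $P_\ell$ the set of $\ell$-dimensional subspaces; put $X=P_k$. The Grassmann graph $\Gamma=J_q(n,k)$ has vertex set $X$, with $x,y\in X$ adjacent iff $\dim(x\cap y)=k-1$; $\partial$ is its path-length distance and $\Gamma(x)$ is the set of neighbours of $x$. Let $E$ be a (real) Euclidean space of dimension $[n]-1$ with inner product $\langle\,,\,\rangle$, and let $P_1\to E$, $s\mapsto\widehat{s}$ be a map such that: $E=\mathrm{Span}\{\widehat{s}\mid s\in P_1\}$; $\|\widehat{s}\|^2=[n]-1$ for $s\in P_1$; $\langle\widehat{s},\widehat{t}\rangle=-1$ for distinct $s,t\in P_1$; and $\sum_{s\in P_1}\widehat{s}=0$. For $u\in P$ define $\widehat{u}=\sum_{s\in P_1,\,s\subseteq u}\widehat{s}$. The group $GL(V)$ acts on $P$, and acts linearly on $E$ by the (unique) action satisfying $\sigma(\widehat{u})=\widehat{\sigma(u)}$ for all $u\in P$, $\sigma\in GL(V)$. For $u,v\in P$, $\mathrm{Stab}(u,v)$ is the subgroup of $GL(V)$ of elements $\sigma$ with $\sigma(u)=u$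 and $\sigma(v)=v$, and $\mathrm{Fix}(u,v)$ is the subspace of $E$ of vectors fixed by every element of $\mathrm{Stab}(u,v)$. For $x,y\in X$ with $1<\partial(x,y)<k$ define $\mathcal{B}_{xy}=\{z\in\Gamma(x)\mid\partial(y,z)=\partial(x,y)+1\}$, $\mathcal{C}_{xy}=\{z\in\Gamma(x)\mid\partial(y,z)=\partial(x,y)-1\}$, and $B_{xy}=\sum_{z\in\mathcal{B}_{xy}}\widehat{z}$, $C_{xy}=\sum_{z\in\mathcal{C}_{xy}}\widehat{z}$. *)

(* Defs.v *)
From HB Require Import structures.
From mathcomp Require Import all_boot all_order all_algebra.
From mathcomp Require Import reals.

Set Implicit Arguments.
Unset Strict Implicit.
Unset Printing Implicit Defensive.

(* VectorInternalTheory provides the subtype structures through which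
   {vspace V} and 'End(V) inherit finiteness from matrices over F. *)
Import VectorInternalTheory GRing.Theory Num.Theory.
Local Open Scope ring_scope.

Section FiniteVectorSpace.
Variables (F : finFieldType) (V : vectType F).

HB.instance Definition _ := [Countable of {vspace V} by <:].
HB.instance Definition _ := [Finite of {vspace V} by <:].
HB.instance Definition _ := [Countable of 'End(V) by <:].
HB.instance Definition _ := [Finite of 'End(V) by <:].

(* The set P_l of l-dimensional subspaces of V. *)
Definition subspace (l : nat) : predArgType :=
  {u : {vspace V} | \dim u == l}.

Definition GL : predArgType := {f : 'End(V) | lker f == 0%VS}.

Definition Stab (u v : {vspace V}) : {set GL} :=
  [set g : GL | (val g @: u == u)%VS && (val g @: v == v)%VS].

Definition grassmann k : rel (subspace k) :=
  fun x y => \dim (val x :&: val y) == (k - 1)%N.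

End FiniteVectorSpace.

Section GraphDistance.
Variables (T : finType) (e : rel T).

Definition walk (m : nat) (x y : T) : bool :=
  [exists p : m.-tuple T, path e x p && (last x p == y)].

(* The least length of an e-path from x to y: when there is one, there is one
   of length less than #|T|.  The value is #|T| when y is not reachable. *)
Definition gdist (x y : T) : nat :=
  find (fun m => walk m x y) (iota 0 #|T|).

End GraphDistance.

Definition grassmann_dist (F : finFieldType) (V : vectType F) k
    (x y : subspace V k) : nat :=
  gdist (@grassmann F V k) x y.

Definition qint (R : realType) (q : nat) (m : int) : R :=
  (q%:R ^ m - 1) / (q%:R - 1).

Section Representation.
Variables (F : finFieldType) (V : vectType F) (R : realType) (E : vectType R).
Variable h : subspace V 1 -> E.

Definition hat (u : {vspace V}) : E :=
  \sum_(s : subspace V 1 | (val s <= u)%VS) h s.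

Record spherical_rep (ip : {dot E for idfun}) : Prop := SphericalRep {
  rep_span : <<[seq h s | s : subspace V 1]>>%VS = fullv;
  rep_norm : forall s, ip (h s) (h s) = qint R #|F| (\dim {:V})%:Z - 1;
  rep_ip : forall s t, s != t -> ip (h s) (h t) = -1;
  rep_sum : \sum_s h s = 0
}.

(* Since the vectors h s span E, this determines act and makes it
   multiplicative. *)
Definition induced_action (act : GL V -> 'End(E)) : Prop :=
  forall (g : GL V) (u : {vspace V}), act g (hat u) = hat (val g @: u).

Definition Fix (act : GL V -> 'End(E)) (u v : {vspace V}) : {vspace E} :=
  (\bigcap_(g in Stab u v) fixedSpace (act g))%VS.

Section Pair.
Variables (k : nat) (x y : subspace V k).

Definition Bset : {set subspace V k} :=
  [set z | grassmann x z && (grassmann_dist y z == grassmann_dist x y + 1)%N].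

Definition Cset : {set subspace V k} :=
  [set z | grassmann x z && (grassmann_dist y z == grassmann_dist x y - 1)%N].

Definition Bvec : E := \sum_(z in Bset) hat (val z).
Definition Cvec : E := \sum_(z in Cset) hat (val z).

End Pair.
End Representation.

(* Main.v *)
Require Import Defs.
From HB Require Import structures.
From mathcomp Require Import all_boot all_order all_algebra finfield.
From mathcomp Require Import reals.
From mathcomp Require Import zify ring.

Set Implicit Arguments.
Unset Strict Implicit.
Unset Printing Implicit Defensive.

Import GRing.Theory Num.Theory.
Local Open Scope ring_scope.

(** Write q for the order of F, N for the dimension of V, [m] for
(q^m - 1)/(q - 1), W for the intersection of x and y, and S for their sum.

Spanning.  The vectors h s form a tight frame: [N] v is the sum over all points
s of <v, h s> h s ([tight_frame]).  The group acts on E by isometries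
([ip_act]), so for v in Fix(x, y) the coefficient <v, h s> depends only on the
orbit of s under Stab(x, y).  Transvections show that this orbit is determined
by which of x, y, S contain s ([Stab_transitive_points]); there are five
classes, and a function constant on them is a combination of the indicators of
V, S, x, y and W.  Since the vectors h s add up to 0, the hat of V vanishes, and
Fix(x, y) lies in the span of the hats of W, x, y and S ([Fix_sub_span]).
Hence its dimension is at most 4, and it is enough to show that the four given
vectors lie in it and are independent.

Membership.  The distance in the Grassmann graph is k - dim(x :&: y)
([grassmann_distE]), so B_xy and C_xy are defined by dimensions of
intersections with x and y.  The stabilizer preserves them and permutes the
summands of the two vectors ([sum_hat_in_Fix]).

Independence.  By double counting, <hat u, hat w> is
[N] [dim (u :&: w)] - [dim u] [dim w] ([ip_hat]).  For z in B_xy the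
dimensions of the intersections of z with W, x, y, S are
dim W - 1, k - 1, dim W - 1, k - 1, and for z in C_xy they are
dim W, k - 1, dim W + 1, k.  Taking the inner products of a linear relation
with the hats of W, x, y and S therefore yields explicit equations in powers of
q, without any count of B_xy or C_xy beyond their being nonempty.  Eliminating
([gram_system_trivial]) leaves a single quantity multiplied by
q^N - q^(2k), which is nonzero because N > 2k. *)

(** * Distance in a finite graph *)

(** The distance is a search bounded by the number of vertices, so the length m of
a shortest walk must be shown to be below that bound: removing the loops of
such a walk keeps its length, so its m + 1 vertices are distinct. *)
Lemma gdist_eq (T : finType) (e : rel T) (m : nat) (x y : T) :
  walk e m x y -> (forall m', walk e m' x y -> (m <= m')%N) ->
  gdist e x y = m.
Proof.
move=> wm minm.
have lt_mT : (m < #|T|)%N.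
  have /existsP[p /andP[ep /eqP lastp]] := wm.
  case/shortenP: ep lastp => p' ep' up' _ lastp'.
  have: (m <= size p')%N.
    by apply: minm; apply/existsP; exists (in_tuple p'); rewrite ep' lastp' /=.
  move=> /leq_ltn_trans; apply.
  by have := max_card (mem (x :: p')); rewrite (card_uniqP up').
rewrite /gdist; set a := fun _ => _.
have has_a : has a (iota 0 #|T|).
  by apply/hasP; exists m; rewrite ?mem_iota.
have lt_fT : (find a (iota 0 #|T|) < #|T|)%N.
  by move: has_a; rewrite has_find size_iota.
apply/eqP; rewrite eqn_leq; apply/andP; split.
  rewrite leqNgt; apply/negP => lt_mf.
  by have := before_find 0%N lt_mf; rewrite nth_iota // /a add0n wm.
by apply: minm; have := nth_find 0%N has_a; rewrite nth_iota.
Qed.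

(** * Subspaces, points and transvections over a finite field *)

(** The finiteness of the carrier of V comes only through its copy
[finvect_type V], hence this form of the count. *)
Lemma card_finvect (F : finFieldType) (V : vectType F) (U : {vspace V}) :
  #|[pred w : finvect_type V | (w : V) \in U]| = (#|F| ^ \dim U)%N.
Proof.
case: V U => T c U; rewrite -(@card_vspace F (finvect_type (Vector.Pack c)) c U).
exact: eq_card.
Qed.

Section Subspaces.
Variables (F : finFieldType) (V : vectType F).
Implicit Types (u v w : V) (A B U x y : {vspace V}).

Lemma dim_cap_ge A B U : (A <= U)%VS -> (B <= U)%VS ->
  (\dim A + \dim B <= \dim U + \dim (A :&: B))%N.
Proof.
move=> sAU sBU; rewrite -dimv_sum_cap leq_add2r dimvS //.
by rewrite subv_add sAU.
Qed.

(** The functional is a coordinate of the projection onto a complement of U along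
U: that projection kills exactly U, so some coordinate of the image of v is
nonzero. *)
Lemma functional_exists1 U v : v \notin U ->
  exists f : 'Hom(V, F^o), (forall u, u \in U -> f u = 0) /\ f v != 0.
Proof.
move=> vU; pose p := daddv_pi (U^C)%VS U.
have UC0 : (U^C :&: U = 0)%VS by rewrite capvC capv_compl.
have pK u : p u + daddv_pi U (U^C)%VS u = u.
  by apply: daddv_pi_add; rewrite // addvC addv_complf memvf.
have pU u : u \in U -> p u = 0.
  move=> uU; have := pK u; rewrite daddv_pi_id ?capv_compl //.
  by move=> /(canRL (addrK _)); rewrite subrr.
have pv : p v != 0.
  apply: contraNneq vU => pv0.
  by rewrite -(pK v) pv0 add0r memv_pi.
pose X := vbasis {:V}.
have [j cj] : exists j, coord X j (p v) != 0.
  apply/existsP; apply: contra_neqT pv; rewrite negb_exists => /forallP c0.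
  rewrite (coord_vbasis (memvf (p v))) big1 // => i _.
  by have := c0 i; rewrite negbK => /eqP->; rewrite scale0r.
exists (linfun (coord X j : V -> F^o) \o p)%VF; split.
  by move=> u /pU pu0; rewrite comp_lfunE pu0 linear0.
by rewrite comp_lfunE lfunE.
Qed.

(** If neither of two functionals, one for v and one for v', works for both vectors,
then each kills the other vector and their sum works. *)
Lemma functional_exists2 U v v' : v \notin U -> v' \notin U ->
  exists f : 'Hom(V, F^o),
    [/\ forall u, u \in U -> f u = 0, f v != 0 & f v' != 0].
Proof.
move=> /functional_exists1[f [fU fv]] /functional_exists1[f' [f'U f'v']].
have [fv'0|fv'] := eqVneq (f v') 0; last by exists f.
have [f'v0|f'v] := eqVneq (f' v) 0; last by exists f'.
exists (f + f'); split=> [u uU||]; rewrite add_lfunE.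
- by rewrite fU // f'U // addr0.
- by rewrite f'v0 addr0.
- by rewrite fv'0 add0r.
Qed.

(** H is the kernel in U of a functional that kills A but not v. *)
Lemma hyperplane_avoiding A U v : (A <= U)%VS -> v \in U -> v \notin A ->
  exists H, [/\ (A <= H)%VS, (H <= U)%VS, v \notin H & (\dim H).+1 = \dim U].
Proof.
move=> sAU vU /functional_exists1[f [fA fv]].
exists (U :&: lker f)%VS; split.
- rewrite subv_cap sAU; apply/subvP => u uA.
  by rewrite memv_ker fA.
- exact: capvSl.
- by rewrite memv_cap memv_ker (negPf fv) andbF.
rewrite -(limg_ker_dim f U) -addn1; congr addn.
apply/eqP; rewrite eq_sym eqn_leq; apply/andP; split.
  by rewrite (leq_trans (dimvS (subvf _))) // dimvf.
rewrite lt0n dimv_eq0; apply: contra_neq fv => fU0.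
by apply/eqP; rewrite -memv0 -fU0 memv_img.
Qed.

Definition gl_of (f : 'End(V)) (f_inj : lker f == 0%VS) : GL V := exist _ f f_inj.

Lemma dim_limg_gl (g : GL V) U : \dim (val g @: U) = \dim U.
Proof. by apply: limg_dim_eq; rewrite (eqP (valP g)) capv0. Qed.

Lemma gl_stabilizes (g : GL V) U :
  (forall u, u \in U -> val g u \in U) -> (val g @: U == U)%VS.
Proof.
move=> gU; rewrite eqEdim dim_limg_gl leqnn andbT.
by apply/subvP => _ /memv_imgP[u uU ->]; apply: gU.
Qed.

(** The map u |-> u + (f u / f v) (v' - v), where f kills U but neither v nor v'.
It is injective since f (g u) = f u * (f v' / f v). *)
Lemma transvection U v v' : v \notin U -> v' \notin U ->
  exists g : GL V, [/\ val g v = v', forall u, u \in U -> val g u = u &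
    forall u, val g u - u \in <[v' - v]>%VS].
Proof.
move=> vU v'U; have [f [fU fv fv']] := functional_exists2 vU v'U.
pose d := v' - v.
pose t u := u + ((f u / f v) *: d : V).
have t_lin : linear t.
  move=> a u w; rewrite /t linearP (scalerDr a) addrACA scalerA -scalerDl.
  by congr (_ + _ *: _); rewrite mulrDl /GRing.scale /= mulrA.
pose tM := GRing.isLinear.Build F V V *:%R t t_lin.
pose tL : {linear V -> V} := HB.pack t tM.
have tE u : linfun tL u = t u by rewrite lfunE.
have t_inj : lker (linfun tL) == 0%VS.
  rewrite -subv0; apply/subvP => u; rewrite memv_ker memv0 tE /t => /eqP tu0.
  have: f (u + (f u / f v) *: d) = 0 by rewrite tu0 linear0.
  rewrite linearD linearZ /= linearB /= => E.
  have : f u * (f v' / f v) = 0.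
    have eqF (a b c : F) : b != 0 -> a * (c / b) = a + (a / b) * (c - b).
      by move=> b0; field.
    by rewrite -[RHS]E; apply: eqF.
  move/eqP; rewrite !mulf_eq0 invr_eq0 (negPf fv) (negPf fv') !orbF.
  by move=> /eqP fu0; move: tu0; rewrite fu0 mul0r scale0r addr0 => ->.
exists (gl_of t_inj); split => [|u uU|u] /=; rewrite tE /t.
- by rewrite divff // scale1r addrC subrK.
- by rewrite fU // mul0r scale0r addr0.
- by rewrite addrC addKr memvZ // memv_line.
Qed.

(** A subspace is preserved by the transvection from v to v' as soon as it is fixed
pointwise or contains the direction v' - v. *)
Lemma transvection_stab U x y v v' : v \notin U -> v' \notin U ->
    (x <= U)%VS || (v' - v \in x) -> (y <= U)%VS || (v' - v \in y) ->
  exists g : GL V, [/\ g \in Stab x y, val g v = v' &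
    forall u, u \in U -> val g u = u].
Proof.
move=> vU v'U hx hy; have [g [gv gU gd]] := transvection vU v'U.
have stab z : (z <= U)%VS || (v' - v \in z) -> (val g @: z == z)%VS.
  move=> hz; apply: gl_stabilizes => u uz; case/orP: hz => [zU|dz].
    by rewrite gU // (subvP zU).
  rewrite -(subrK u (val g u)) memvD //; apply: subvP (gd u).
  by rewrite -memvE.
by exists g; split=> //; rewrite inE !stab.
Qed.

(** The orbits of nonzero vectors.  Each class is handled by one transvection that
fixes a suitable subspace pointwise, except the vectors of x + y outside both
x and y: writing v = a + b and v' = a' + b', move a to a' while fixing y, then
b to b' while fixing x. *)
Lemma Stab_transitive x y v v' : v != 0 -> v' != 0 ->
    (v \in x) = (v' \in x) -> (v \in y) = (v' \in y) ->
    (v \in (x + y)%VS) = (v' \in (x + y)%VS) ->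
  exists2 g : GL V, g \in Stab x y & val g v = v'.
Proof.
move=> v0 v'0 ex ey eS.
have [vx|vx] := boolP (v \in x); have [vy|vy] := boolP (v \in y).
- have [||||g [gS gv _]] := @transvection_stab 0%VS x y v v'; rewrite ?memv0 //.
  + by rewrite memvB ?orbT // -ex.
  + by rewrite memvB ?orbT // -ey.
  by exists g.
- have [||||g [gS gv _]] := @transvection_stab y x y v v'; rewrite -?ey //.
  + by rewrite memvB ?orbT // -ex.
  + by rewrite subvv.
  by exists g.
- have [||||g [gS gv _]] := @transvection_stab x x y v v'; rewrite -?ex //.
  + by rewrite subvv.
  + by rewrite memvB ?orbT // -ey.
  by exists g.
have [vS|vS] := boolP (v \in (x + y)%VS); last first.
  have [||||g [gS gv _]] := @transvection_stab (x + y)%VS x y v v'.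
  + by [].
  + by rewrite -eS.
  + by rewrite addvSl.
  + by rewrite addvSr.
  by exists g.
have /memv_addP[a ax [b b_y def_v]] := vS.
have /memv_addP[a' a'x [b' b'y def_v']] : v' \in (x + y)%VS by rewrite -eS.
have ay : a \notin y by rewrite def_v rpredDr in vy.
have bx : b \notin x by rewrite def_v rpredDl in vx.
have a'y : a' \notin y by rewrite ey def_v' rpredDr in vy.
have b'x : b' \notin x by rewrite ex def_v' rpredDl in vx.
have [|//|g [+ ga gy]] := @transvection_stab y x y a a' ay a'y.
  by rewrite memvB ?orbT.
  by rewrite subvv.
have [//||g' [+ g'b g'x]] := @transvection_stab x x y b b' bx b'x.
  by rewrite subvv.
  by rewrite memvB ?orbT.
rewrite !inE => /andP[/eqP g'Sx /eqP g'Sy] /andP[/eqP gSx /eqP gSy].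
have gg_inj : lker (val g' \o val g)%VF == 0%VS.
  apply/lker0P => u w; rewrite !comp_lfunE.
  by move=> /(lker0P (valP g')) /(lker0P (valP g)).
exists (gl_of gg_inj).
  by rewrite !inE /= !limg_comp gSx gSy g'Sx g'Sy !eqxx.
by rewrite /= comp_lfunE def_v linearD /= ga gy // linearD /= g'b g'x.
Qed.

Lemma subspace1P (s : subspace V 1) : {v | v != 0 & val s = <[v]>%VS}.
Proof.
exists (vpick (val s)).
  by rewrite vpick0 -dimv_eq0 (eqP (valP s)).
apply/eqP; rewrite eq_sym eqEdim -memvE memv_pick dim_vline vpick0 -dimv_eq0.
by rewrite (eqP (valP s)).
Qed.

Lemma subspace1_eq (s t : subspace V 1) : (val s <= val t)%VS = (s == t).
Proof.
by rewrite -val_eqE /= eqEdim (eqP (valP s)) (eqP (valP t)) andbT.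
Qed.

Definition subspace_of l U (dU : \dim U == l) : subspace V l := exist _ U dU.

Lemma dim_point v : v != 0 -> \dim <[v]> == 1%N.
Proof. by rewrite dim_vline => ->. Qed.

Definition point_of v (v0 : v != 0) : subspace V 1 := subspace_of (dim_point v0).

Definition npoints U := #|[set s : subspace V 1 | (val s <= U)%VS]|.

(** Each nonzero vector of U spans exactly one point, and each point contains
#|F| - 1 nonzero vectors. *)
Lemma npointsE U : (npoints U * (#|F| - 1) = #|F| ^ \dim U - 1)%N.
Proof.
pose W := finvect_type V.
have cardU (X : {vspace V}) :
    #|[set w : W | (w != 0) && ((w : V) \in X)]| = (#|F| ^ \dim X - 1)%N.
  rewrite -card_finvect [in RHS](cardD1 (0 : W)) inE mem0v add1n subn1 /=.
  by apply: eq_card => w; rewrite !inE.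
rewrite -cardU -sum1_card; under [RHS]eq_bigl do rewrite inE.
transitivity (\sum_(w : W | (w != 0%R) && ((w : V) \in U))
   \sum_(s : subspace V 1 | (val s <= U)%VS && ((w : V) \in val s)) 1)%N; last first.
  apply: eq_bigr => w /andP[w0 wU]; apply: (big_pred1 (point_of w0)) => s.
  have -> : ((w : V) \in val s) = (s == point_of w0).
    by rewrite memvE eq_sym; apply: (subspace1_eq (point_of w0) s).
  rewrite -[RHS]/(s == point_of w0).
  have [->|_] := eqVneq s (point_of w0); last by rewrite andbF.
  by rewrite andbT; apply: wU.
rewrite (exchange_big_dep (fun s : subspace V 1 => (val s <= U)%VS)) /=; last first.
  by move=> w s _ /andP[].
rewrite /npoints -sum1_card big_distrl /=; under eq_bigl do rewrite inE.
apply: eq_bigr => s sU; rewrite mul1n.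
have := cardU (val s); rewrite (eqP (valP s)) expn1 => <-.
rewrite -sum1_card; apply: eq_bigl => w; rewrite inE sU /=.
have [ws|_] := boolP ((w : V) \in val s); last by rewrite !andbF.
by rewrite (subvP sU _ ws) !andbT.
Qed.

End Subspaces.

(** * The Grassmann graph *)

Section Grassmann.
Variables (F : finFieldType) (V : vectType F) (k : nat).
Implicit Types x y z : subspace V k.

Lemma dim_subspace x : \dim (val x) = k.
Proof. exact: (eqP (valP x)). Qed.

(** One step in the graph changes the dimension of the intersection with a given
vertex by at most one; this is the lower bound on the distance. *)
Lemma path_grassmann x (p : seq (subspace V k)) : path (@grassmann F V k) x p ->
  (k <= size p + \dim (val x :&: val (last x p)))%N.
Proof.
elim: p x => [|y p IHp] x; first by rewrite capvv dim_subspace.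
rewrite [path _ _ _]/= [last _ _]/= [size _]/=.
case/andP => /eqP xy /IHp; set z := last y p => le_k.
have := @dim_cap_ge _ _ (val x :&: val y)%VS (val y :&: val z)%VS (val y) (capvSr _ _) (capvSl _ _).
rewrite xy dim_subspace.
have: (\dim (val x :&: val y :&: (val y :&: val z)) <= \dim (val x :&: val z))%N.
  by apply/dimvS/capvS; rewrite ?capvSl ?capvSr.
lia.
Qed.

(** Neighbours of x arise by exchanging a vector: keep a hyperplane H of x and add
a vector outside x. *)
Lemma extend_hyperplane x (H : {vspace V}) v : (H <= val x)%VS -> (\dim H).+1 = k ->
    v \notin val x ->
  exists2 z : subspace V k, val z = (H + <[v]>)%VS & grassmann x z.
Proof.
move=> sHx dH vx.
have dz : \dim (H + <[v]>) == k.
  rewrite dimv_disjoint_sum.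
    rewrite dim_vline (_ : v != 0) ?addn1 ?dH //.
    by apply: contraNneq vx => ->; rewrite mem0v.
  apply/eqP; rewrite -subv0; apply/subvP => u /memv_capP[uH /vlineP[c def_u]].
  rewrite memv0 def_u; move: (subvP sHx _ uH).
  by rewrite def_u rpredZeq (negPf vx) orbF => /eqP->; rewrite scale0r.
exists (subspace_of dz) => //; rewrite /grassmann [val (subspace_of _)]/=.
have le_H : (\dim H <= \dim (val x :&: (H + <[v]>)))%N.
  by rewrite dimvS // subv_cap sHx addvSl.
suff : (\dim (val x :&: (H + <[v]>)) < k)%N by lia.
rewrite -[X in (_ < X)%N](eqP dz) (ltn_leqif (dimv_leqif_sup (capvSr _ _))).
apply: contra vx => /subvP/(_ v); rewrite memv_cap => /(_ _)/andP[] //.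
by rewrite memvE addvSr.
Qed.

(** Keep a hyperplane of x through the intersection with y and add a vector of y. *)
Lemma exists_neighbour_closer x y : (\dim (val x :&: val y) < k)%N ->
  exists2 z, grassmann x z & \dim (val z :&: val y) = (\dim (val x :&: val y)).+1.
Proof.
move=> lt_k.
have /subvPn[a ax ay] : ~~ (val x <= val y)%VS.
  by apply: contraL lt_k => /capv_idPl->; rewrite dim_subspace ltnn.
have /subvPn[b b_y bx] : ~~ (val y <= val x)%VS.
  by apply: contraL lt_k => /capv_idPr->; rewrite dim_subspace ltnn.
have aW : a \notin (val x :&: val y)%VS by rewrite memv_cap (negPf ay) andbF.
have [H [sWH sHx _ dH]] := hyperplane_avoiding (capvSl _ _) ax aW.
rewrite dim_subspace in dH.
have [z def_z xz] := extend_hyperplane sHx dH bx; exists z => //.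
have bz : b \in val z.
  by rewrite memvE def_z addvSr.
have := @dim_cap_ge _ _ (val x :&: val z)%VS (val z :&: val y)%VS _ (capvSr _ _) (capvSl _ _).
have: (\dim (val x :&: val z :&: (val z :&: val y)) <= \dim (val x :&: val y))%N.
  by apply/dimvS/capvS; rewrite ?capvSl ?capvSr.
rewrite dim_subspace (eqP xz) => le1 le2.
suff lt : (\dim (val x :&: val y) < \dim (val z :&: val y))%N.
  have arith (m c w : nat) : (w < k -> w < m -> c <= w -> k - 1 + m <= k + c -> m = w.+1)%N.
    by lia.
  exact: arith lt_k lt le1 le2.
rewrite (ltn_leqif (dimv_leqif_sup _)).
  by apply/subvPn; exists b; rewrite memv_cap ?bz ?b_y // (negPf bx).
rewrite subv_cap capvSr andbT def_z (subv_trans sWH) ?addvSl //.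
Qed.

(** Keep a hyperplane of x that misses a vector of the intersection with y, and add
a vector outside x + y. *)
Lemma exists_neighbour_farther x y : (0 < \dim (val x :&: val y))%N ->
    (\dim (val x + val y) < \dim {:V})%N ->
  exists2 z, grassmann x z & (\dim (val z :&: val y)).+1 = \dim (val x :&: val y).
Proof.
move=> lt_0 lt_n.
pose w := vpick (val x :&: val y)%VS.
have wW : w \in (val x :&: val y)%VS by apply: memv_pick.
have w0 : w \notin (0 : {vspace V})%VS by rewrite memv0 vpick0 -dimv_eq0 -lt0n.
have /subvPn[v _ vS] : ~~ ({:V} <= val x + val y)%VS.
  by apply: contraL lt_n => /dimvS; rewrite leqNgt.
have [wx wy] := memv_capP wW.
have [H [_ sHx wH dH]] := hyperplane_avoiding (sub0v _) wx w0.
rewrite dim_subspace in dH.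
have vx : v \notin val x by apply: contra vS; apply/subvP/addvSl.
have [z def_z xz] := extend_hyperplane sHx dH vx; exists z => //.
have szW : (val z :&: val y <= val x :&: val y)%VS.
  apply/subvP => u /memv_capP[]; rewrite def_z.
  move=> /memv_addP[h hH [_ /vlineP[c ->] ->]] uy.
  have hx := subvP sHx h hH.
  suff c0 : c = 0 by rewrite memv_cap uy c0 scale0r addr0 hx.
  apply/eqP; apply: contraR vS => c0.
  have : c *: v \in (val x + val y)%VS.
    rewrite -(addKr h (c *: v)) memv_add //; first by rewrite memvN.
  by rewrite rpredZeq (negPf c0).
have lt_zW : (\dim (val z :&: val y) < \dim (val x :&: val y))%N.
  rewrite (ltn_leqif (dimv_leqif_sup szW)); apply/subvPn; exists w => //.
  rewrite memv_cap wy andbT def_z; apply: contra wH.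
  move=> /memv_addP[h hH [_ /vlineP[c ->] def_w]].
  suff c0 : c = 0 by rewrite def_w c0 scale0r addr0.
  apply/eqP; apply: contraR vx => c0.
  have : c *: v \in val x.
    by rewrite -(addKr h (c *: v)) -def_w memvD ?memvN // (subvP sHx).
  by rewrite rpredZeq (negPf c0).
have := @dim_cap_ge _ _ (val x :&: val z)%VS (val x :&: val y)%VS _ (capvSl _ _) (capvSl _ _).
have: (\dim (val x :&: val z :&: (val x :&: val y)) <= \dim (val z :&: val y))%N.
  by apply/dimvS/capvS; rewrite ?capvSr.
rewrite dim_subspace (eqP xz) => le1 le2.
have arith (m c j : nat) : (m < j -> c <= m -> k - 1 + j <= k + c -> m.+1 = j)%N.
  by clear; lia.
exact: arith lt_zW le1 le2.
Qed.

Lemma grassmann_distE x y : grassmann_dist x y = (k - \dim (val x :&: val y))%N.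
Proof.
apply: gdist_eq; last first.
  move=> m /existsP[p /andP[/path_grassmann + /eqP lastp]].
  by rewrite lastp size_tuple; lia.
suff walk_m m z : (k - \dim (val z :&: val y))%N = m -> walk (@grassmann F V k) m z y.
  exact: walk_m.
elim: m z => [|m IHm] {}x def_m.
  apply/existsP; exists [tuple] => /=.
  rewrite -val_eqE /= eqEdim !dim_subspace leqnn andbT.
  suff /eqP <- : (val x :&: val y == val x)%VS by apply: capvSr.
  by rewrite eqEdim capvSl dim_subspace -subn_eq0 def_m.
have [|z xz dz] := @exists_neighbour_closer x y; first lia.
have [|p /andP[zp lastp]] := existsP (IHm z _); first by lia.
by apply/existsP; exists (cons_tuple z p); rewrite /= xz zp.
Qed.

End Grassmann.

(** * The action of GL(V), and the neighbours of x nearer to or farther from y *)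

Section GLAction.
Variables (F : finFieldType) (V : vectType F).
Implicit Type g : GL V.

Lemma dim_gl_image k g (z : subspace V k) : \dim (val g @: val z) == k.
Proof. by rewrite dim_limg_gl dim_subspace. Qed.

Definition gl_image k g (z : subspace V k) : subspace V k :=
  subspace_of (dim_gl_image g z).

Lemma val_gl_image k g (z : subspace V k) : val (gl_image g z) = (val g @: val z)%VS.
Proof. by []. Qed.

Lemma gl_image_inj k g : injective (@gl_image k g).
Proof.
move=> z z' /(congr1 val)/eqP; rewrite !val_gl_image eq_limg_ker0 ?(valP g) //.
by move=> /eqP/val_inj.
Qed.

Lemma dim_cap_gl g (A B : {vspace V}) : (val g @: A == A)%VS ->
  \dim (A :&: (val g @: B)) = \dim (A :&: B).
Proof.
move=> /eqP gA; rewrite -{1}gA -lker0_img_cap ?(valP g) //.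
by rewrite dim_limg_gl.
Qed.

Lemma Stab_transitive_points (x y : {vspace V}) (s t : subspace V 1) :
    (val s <= x)%VS = (val t <= x)%VS -> (val s <= y)%VS = (val t <= y)%VS ->
    (val s <= x + y)%VS = (val t <= x + y)%VS ->
  exists2 g, g \in Stab x y & gl_image g s = t.
Proof.
have [v v0 sE] := subspace1P s; have [w w0 tE] := subspace1P t.
rewrite sE tE -!memvE => ex ey eS.
have [g gS gv] := Stab_transitive v0 w0 ex ey eS.
by exists g => //; apply: val_inj; rewrite val_gl_image sE tE limg_line gv.
Qed.
End GLAction.

Section Neighbours.
Variables (F : finFieldType) (V : vectType F) (k : nat).
Implicit Types x y z : subspace V k.

Lemma dim_cap_le_k x y : (\dim (val x :&: val y) <= k)%N.
Proof. by rewrite -[X in (_ <= X)%N](dim_subspace x) dimvS ?capvSl. Qed.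

Lemma mem_Bset x y z : (z \in Bset x y) =
  grassmann x z && ((\dim (val z :&: val y)).+1 == \dim (val x :&: val y)).
Proof.
rewrite inE !grassmann_distE [in X in (_ == X + 1)%N]capvC (capvC (val y)).
rewrite (capvC (val y)); congr (_ && _).
have := dim_cap_le_k z y; have := dim_cap_le_k x y.
move: (\dim _) (\dim _) => a b; clear => la lb; apply/eqP/eqP; lia.
Qed.

Lemma mem_Cset x y z : (\dim (val x :&: val y) < k)%N -> (z \in Cset x y) =
  grassmann x z && (\dim (val z :&: val y) == (\dim (val x :&: val y)).+1).
Proof.
rewrite inE !grassmann_distE (capvC (val y)) => lt_k.
congr (_ && _); move: lt_k; have := dim_cap_le_k z y.
move: (\dim _) (\dim _) => a b; clear => la lb; apply/eqP/eqP; lia.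
Qed.

(** The intersection with x :&: y loses at most one dimension, as z meets x in a
hyperplane.  If z were inside x + y, the dimension formula there would force a
larger intersection with y. *)
Lemma dims_farther x y z : grassmann x z ->
    (\dim (val z :&: val y)).+1 = \dim (val x :&: val y) ->
  \dim (val z :&: (val x :&: val y)) = \dim (val z :&: val y) /\
  \dim (val z :&: (val x + val y)) = (k - 1)%N.
Proof.
move=> /eqP xz zy.
have le1 : (\dim (val z :&: (val x :&: val y)) <= \dim (val z :&: val y))%N.
  by rewrite dimvS // capvS ?capvSr.
have := @dim_cap_ge _ _ (val x :&: val z)%VS (val x :&: val y)%VS _ (capvSl _ _) (capvSl _ _).
have -> : (val x :&: val z :&: (val x :&: val y) = val z :&: (val x :&: val y))%VS.
  rewrite -capvA (capvC (val x)) -capvA; congr (_ :&: _)%VS.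
  by rewrite -capvA (capvC (val y)) capvA capvv.
rewrite xz dim_subspace => le2.
have le3 : (k - 1 <= \dim (val z :&: (val x + val y)))%N.
  by rewrite -xz dimvS // capvC capvS ?addvSl.
have lt4 : (\dim (val z :&: (val x + val y)) < k)%N.
  rewrite -[X in (_ < X)%N](dim_subspace z) (ltn_leqif (dimv_leqif_sup (capvSl _ _))).
  apply/negP; rewrite subv_cap subvv => /= szS.
  have := @dim_cap_ge _ _ _ _ _ szS (addvSr (val x) (val y)).
  have := dimv_sum_cap (val x) (val y); rewrite -zy !dim_subspace.
  by move: (\dim _) (\dim _) => a b; clear; lia.
split; last by move: le3 lt4; move: (\dim _) => a; clear; lia.
move: le1 le2 zy; move: (\dim _) (\dim _) (\dim _) => a b c; clear; lia.
Qed.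

(** The intersections of z with x and with y already generate z, by dimension. *)
Lemma dims_closer x y z : grassmann x z -> (0 < k)%N ->
    \dim (val z :&: val y) = (\dim (val x :&: val y)).+1 ->
  \dim (val z :&: (val x :&: val y)) = \dim (val x :&: val y) /\
  \dim (val z :&: (val x + val y)) = k.
Proof.
move=> /eqP xz k_gt0 zy.
have capE : (val x :&: val z :&: (val z :&: val y) = val z :&: (val x :&: val y))%VS.
  by rewrite (capvC (val x)) -capvA (capvA (val x)) (capvC (val x)) !capvA capvv.
have le1 : (\dim (val z :&: (val x :&: val y)) <= \dim (val x :&: val y))%N.
  by rewrite dimvS // capvSr.
have sz : (val x :&: val z + val z :&: val y <= val z :&: (val x + val y))%VS.
  rewrite subv_add !subv_cap capvSr capvSl /=.
  by rewrite (subv_trans (capvSl _ _) (addvSl _ _)) (subv_trans (capvSr _ _) (addvSr _ _)).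
have := dimv_sum_cap (val x :&: val z) (val z :&: val y).
rewrite capE xz zy; have := dimvS sz.
have : (\dim (val z :&: (val x + val y)) <= k)%N.
  by rewrite -[X in (_ <= X)%N](dim_subspace z) dimvS ?capvSl.
move: le1 k_gt0; move: (\dim _) (\dim _) (\dim _) (\dim _) => a b c d; clear.
by move=> *; split; lia.
Qed.

Lemma gl_grassmann_stable (g : GL V) x y z : g \in Stab (val x) (val y) ->
  (grassmann x (gl_image g z) = grassmann x z) *
  (\dim (val (gl_image g z) :&: val y) = \dim (val z :&: val y)).
Proof.
rewrite inE => /andP[gx gy]; split.
  by rewrite /grassmann val_gl_image dim_cap_gl.
by rewrite val_gl_image -!(capvC (val y)) dim_cap_gl.
Qed.
End Neighbours.

(** * The spherical representation and its fixed vectors *)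

Section Representation.
Variables (F : finFieldType) (V : vectType F) (R : realType) (E : vectType R).
Variables (ip : {dot E for idfun}) (h : subspace V 1 -> E).
Hypothesis hrep : spherical_rep h ip.
Local Notation N := (\dim {:V}).
Local Notation qn := (qint R #|F|).

Lemma ip_suml (I : finType) (P : pred I) (f : I -> E) v :
  ip (\sum_(i | P i) f i) v = \sum_(i | P i) ip (f i) v.
Proof. exact: linear_sumlz. Qed.

Lemma ip_sumr (I : finType) (P : pred I) (f : I -> E) v :
  ip v (\sum_(i | P i) f i) = \sum_(i | P i) ip v (f i).
Proof. exact: linear_sumr. Qed.

Lemma ipZl c u v : ip (c *: u) v = c * ip u v.
Proof. exact: linearZl_LR. Qed.

Lemma ipZr c u v : ip u (c *: v) = c * ip u v.
Proof. exact: linearZr_LR. Qed.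

Lemma ipDl u v w : ip (u + v) w = ip u w + ip v w.
Proof. exact: linearDl. Qed.

Lemma npoints_qint (U : {vspace V}) : (npoints U)%:R = qn (\dim U).
Proof.
have q_gt1 : (1 < #|F|)%N by apply: finNzRing_gt1.
have q1 : (#|F|%:R - 1 : R) != 0 by rewrite subr_eq0 pnatr_eq1 neq_ltn q_gt1 orbT.
apply: (mulIf q1); rewrite /qint divfK // -exprnP -natrX.
have q_gt0 := ltnW q_gt1.
have natB m : (0 < m)%N -> m%:R - 1 = (m - 1)%:R :> R by move=> m0; rewrite natrB.
by rewrite !natB ?expn_gt0 ?q_gt0 // -natrM npointsE.
Qed.

Lemma hat_point (s : subspace V 1) : hat h (val s) = h s.
Proof. by rewrite /hat (big_pred1 s) // => t; rewrite subspace1_eq. Qed.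

Lemma hat_full : hat h fullv = 0.
Proof. by rewrite -[RHS](rep_sum hrep); apply: eq_bigl => s; rewrite subvf. Qed.

Lemma ip_points s t : ip (h s) (h t) = qn N * (s == t)%:R - 1.
Proof.
have [->|/(rep_ip hrep)->] := eqVneq s t; first by rewrite (rep_norm hrep) mulr1.
by rewrite mulr0 sub0r.
Qed.

(** Only the common points of u and w contribute the term with qn N; the constant
-1 contributes once for each pair of points. *)
Lemma ip_hat u w :
  ip (hat h u) (hat h w) = qn N * qn (\dim (u :&: w)) - qn (\dim u) * qn (\dim w).
Proof.
have sum1 (U : {vspace V}) : \sum_(s : subspace V 1 | (val s <= U)%VS) 1 = qn (\dim U).
  by rewrite -npoints_qint sumr_const /npoints cardsE.
have ip_point s : ip (h s) (hat h w) = qn N * (val s <= w)%VS%:R - qn (\dim w).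
  rewrite ip_sumr; under eq_bigr do rewrite ip_points.
  rewrite sumrB sum1 -mulr_sumr; congr (_ * _ - _).
  rewrite big_mkcond (bigD1 s) //= eqxx big1 ?addr0; first by case: ifP.
  by move=> t; rewrite eq_sym => /negPf->; rewrite if_same.
rewrite ip_suml; under eq_bigr do rewrite ip_point.
rewrite sumrB -mulr_sumr; congr (_ * _ - _).
  rewrite -sum1 [LHS]big_mkcond [RHS]big_mkcond; apply: eq_bigr => s _ /=.
  by rewrite subv_cap; case: (val s <= u)%VS => //=; case: ifP.
by rewrite -[X in X * _]sum1 mulr_suml; under [RHS]eq_bigr do rewrite mul1r.
Qed.

Lemma qn_neq0 m : (0 < m)%N -> qn m != 0.
Proof.
move=> m0; have q_gt1 : (1 < #|F|)%N by apply: finNzRing_gt1.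
rewrite /qint mulf_neq0 ?invr_eq0 ?subr_eq0 ?pnatr_eq1 ?(gtn_eqF q_gt1) //.
rewrite -exprnP -natrX pnatr_eq1 -[1%N](expn0 #|F|) eqn_exp2l //.
by rewrite -lt0n.
Qed.

Hypothesis dimV_gt0 : (0 < N)%N.

(** Both sides are linear in v, so it is enough to compare them on the vectors h t,
where the Gram matrix and the vanishing of the sum of all h s give the claim. *)
Lemma tight_frame v : qn N *: v = \sum_s ip v (h s) *: h s.
Proof.
(* The defect of the identity, as a linear map whose kernel contains every h t. *)
pose e v := \sum_s ip v (h s) *: h s - qn N *: v.
have e_lin : linear e.
  move=> c u w; rewrite /e scalerBr scalerDr opprD addrACA; congr (_ + _).
    rewrite scaler_sumr -big_split /=; apply: eq_bigr => s _.
    by rewrite ipDl ipZl scalerDl scalerA.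
  by rewrite !scalerA mulrC.
pose eM := GRing.isLinear.Build R E E *:%R e e_lin.
pose eL : {linear E -> E} := HB.pack e eM.
suff : v \in lker (linfun eL).
  by rewrite memv_ker lfunE /= subr_eq0 eq_sym => /eqP.
apply: subvP (memvf v); rewrite -(rep_span hrep); apply/span_subvP.
move=> _ /mapP[t _ ->]; rewrite memv_ker lfunE /= /e.
under eq_bigr do rewrite ip_points scalerBl scale1r.
rewrite sumrB (rep_sum hrep) subr0 (bigD1 t) //= eqxx mulr1 big1 ?addr0 ?subrr //.
by move=> s; rewrite eq_sym => /negPf->; rewrite mulr0 scale0r.
Qed.

Variables (act : GL V -> 'End(E)) (hact : induced_action h act).

Lemma act_point g s : act g (h s) = h (gl_image g s).
Proof. by rewrite -hat_point hact -hat_point. Qed.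

(** The Gram matrix of the vectors h s only distinguishes equal from distinct points,
and the group permutes the points. *)
Lemma ip_act g u v : ip (act g u) (act g v) = ip u v.
Proof.
have span_h w : exists c : subspace V 1 -> R, w = \sum_s c s *: h s.
  exists (fun s => (qn N)^-1 * ip w (h s)).
  under eq_bigr do rewrite -scalerA.
  by rewrite -scaler_sumr -tight_frame scalerA mulVf ?qn_neq0 // scale1r.
have actE (c : subspace V 1 -> R) :
    act g (\sum_s c s *: h s) = \sum_s c s *: h (gl_image g s).
  by rewrite linear_sum; apply: eq_bigr => s _; rewrite linearZ /= act_point.
have [c ->] := span_h u; have [d ->] := span_h v.
rewrite !actE !ip_suml; apply: eq_bigr => s _.
rewrite !ip_sumr; apply: eq_bigr => t _.
by rewrite !ipZl !ipZr !ip_points (inj_eq (@gl_image_inj _ _ 1 g)).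
Qed.

Lemma FixP (x y : {vspace V}) v :
  reflect (forall g, g \in Stab x y -> act g v = v) (v \in Fix act x y).
Proof.
apply: (iffP idP) => [vF g gS|fix_v].
  by apply/fixedSpaceP; move: v vF; apply/subvP; apply: bigcapv_inf gS _.
by rewrite memvE; apply/subv_bigcapP => g gS; rewrite -memvE; apply/fixedSpaceP/fix_v.
Qed.

Lemma hat_sum U : hat h U = \sum_s (val s <= U)%VS%:R *: h s.
Proof.
rewrite /hat big_mkcond; apply: eq_bigr => s _.
by case: (val s <= U)%VS; rewrite ?scale1r ?scale0r.
Qed.

(** On the classes (outside S, in S only, in x only, in y only, in both x and y) a
function is a combination of the indicators of V, S, x, y and x :&: y, found
by inclusion-exclusion; the hat of V is 0. *)
Lemma class_sum_in_span (x y : {vspace V}) (phi : subspace V 1 -> R) :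
    (forall s t : subspace V 1, (val s <= x)%VS = (val t <= x)%VS ->
       (val s <= y)%VS = (val t <= y)%VS ->
       (val s <= x + y)%VS = (val t <= x + y)%VS -> phi s = phi t) ->
  \sum_s phi s *: h s \in
    <<[:: hat h (x :&: y); hat h x; hat h y; hat h (x + y)]>>%VS.
Proof.
move=> phi_class.
(* f reads off the value of phi on a class from any point in it; its value on an
   empty class is arbitrary. *)
pose cls (s : subspace V 1) :=
  ((val s <= x)%VS, (val s <= y)%VS, (val s <= x + y)%VS).
pose f c := if [pick s | cls s == c] is Some s then phi s else 0.
have phiE s : phi s = f (cls s).
  rewrite /f; case: pickP => [t /eqP[e1 e2 e3]|/(_ s)]; last by rewrite eqxx.
  exact: phi_class.
pose b0 := f (false, false, false).
pose bS := f (false, false, true).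
pose bx := f (true, false, true).
pose b_y := f (false, true, true).
pose bW := f (true, true, true).
have -> : \sum_s phi s *: h s =
   b0 *: hat h fullv + (bS - b0) *: hat h (x + y) + (bx - bS) *: hat h x +
   (b_y - bS) *: hat h y + (bW - bx - b_y + bS) *: hat h (x :&: y).
  rewrite !hat_sum !scaler_sumr -!big_split /=; apply: eq_bigr => s _.
  rewrite !scalerA -!scalerDl; congr (_ *: _); rewrite phiE /cls subvf subv_cap.
  have sxS : (val s <= x)%VS -> (val s <= x + y)%VS.
    by move/subv_trans; apply; apply: addvSl.
  have syS : (val s <= y)%VS -> (val s <= x + y)%VS.
    by move/subv_trans; apply; apply: addvSr.
  rewrite /bW /bx /b_y /bS /b0.
  move: (val s <= x)%VS (val s <= y)%VS (val s <= x + y)%VS sxS syS.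
  by move=> [] [] [] sx sy; rewrite /=; solve [by have := sx isT | by have := sy isT | ring].
rewrite hat_full scaler0 add0r.
by rewrite !memvD // memvZ // memv_span // !inE eqxx ?orbT.
Qed.

Lemma Fix_sub_span (x y : {vspace V}) :
  (Fix act x y <=
    <<[:: hat h (x :&: y); hat h x; hat h y; hat h (x + y)]>>)%VS.
Proof.
apply/subvP => v /FixP fix_v.
rewrite -[v](scalerK (qn_neq0 dimV_gt0)) tight_frame memvZ //.
apply: class_sum_in_span => s t ex ey eS.
have [g gS <-] := Stab_transitive_points ex ey eS.
by rewrite -act_point -{2}(fix_v g gS) ip_act.
Qed.

Lemma hat_in_Fix (x y u : {vspace V}) :
  (forall g, g \in Stab x y -> (val g @: u)%VS = u) -> hat h u \in Fix act x y.
Proof. by move=> gu; apply/FixP => g /gu gS; rewrite hact gS. Qed.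

(** The stabilizer permutes the summands. *)
Lemma sum_hat_in_Fix (x y : {vspace V}) k (Z : {set subspace V k}) :
    (forall g z, g \in Stab x y -> (gl_image g z \in Z) = (z \in Z)) ->
  \sum_(z in Z) hat h (val z) \in Fix act x y.
Proof.
move=> ZP; apply/FixP => g gS; rewrite linear_sum.
rewrite [RHS](reindex_inj (@gl_image_inj _ _ k g)).
by apply: eq_big => [z|z _]; [rewrite ZP | apply: hact].
Qed.

End Representation.

(** * Linear independence *)

(** With q the order of the field, a = q^(dim W - 1), t = q^(k - dim W - 1) and N the
number of vectors of V, the five equations say that the function
al [s in x] + be [s in y] + ga b(s) + de c(s) + ep on points, where b(s) and
c(s) are the proportions of B_xy and of C_xy that contain s, has sum 0 over the
points of W, x, y, S and V respectively (times q - 1).  Elimination expresses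
al, be, ga, de as multiples of ep and leaves (N - q^(2k)) ep = 0. *)
Lemma gram_system_trivial (R : fieldType) (q a t N al be ga de ep : R) :
    q != 0 -> q != 1 -> a != 0 -> t != 0 -> t != 1 -> q * t != 1 ->
    N != q ^+ 4 * a ^+ 2 * t ^+ 2 ->
    (al + be + de + ep) * (q * a - 1) + ga * (a - 1) = 0 ->
    (al + ep) * (q ^+ 2 * a * t - 1) + be * (q * a - 1) +
      (ga + de) * (q * a * t - 1) = 0 ->
    al * (q * a - 1) + (be + ep) * (q ^+ 2 * a * t - 1) + ga * (a - 1) +
      de * (q ^+ 2 * a - 1) = 0 ->
    (al + be + de) * (q ^+ 2 * a * t - 1) + ga * (q * a * t - 1) +
      ep * (q ^+ 3 * a * t ^+ 2 - 1) = 0 ->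
    (al + be + ga + de) * (q ^+ 2 * a * t - 1) + ep * (N - 1) = 0 ->
  [/\ al = 0, be = 0, ga = 0 & de = 0].
Proof.
move=> q0 q1 a0 t0 t1 qt1 Nne.
set LW := (X in X = 0 -> _) => eW; set Lx := (X in X = 0 -> _) => ex.
set Ly := (X in X = 0 -> _) => ey; set LS := (X in X = 0 -> _) => eS.
set LV := (X in X = 0 -> _) => eV.
have cancel (c z : R) : c != 0 -> c * z = 0 -> z = 0.
  by move=> c0 /eqP; rewrite mulf_eq0 (negPf c0) => /eqP.
have q1' : q - 1 != 0 by rewrite subr_eq0.
have t1' : t - 1 != 0 by rewrite subr_eq0.
have qt1' : q * t - 1 != 0 by rewrite subr_eq0.
have e1 : ga * (q * a * t * (q - 1)) + ep * (N - q ^+ 3 * a * t ^+ 2) = 0.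
  by transitivity (LV - LS); [rewrite /LV /LS; ring | rewrite eV eS subrr].
have e2 : de * ((q - 1) * (t - 1)) + ep * (q * t - 1) ^+ 2 = 0.
  apply: (cancel (q * a)); first by rewrite mulf_neq0.
  transitivity (LS - Lx - Ly + LW); last by rewrite eS ex ey eW !subrr addr0.
  by rewrite /LS /Lx /Ly /LW; ring.
have e3 : (q - 1) * (q * al + ga + q * ep) - q * ep * (q * t - 1) = 0.
  apply: (cancel (a * (q * t - 1))); first by rewrite mulf_neq0.
  transitivity ((q - 1) * (Lx - LW) -
      a * q * (de * ((q - 1) * (t - 1)) + ep * (q * t - 1) ^+ 2)).
    by rewrite /Lx /LW; ring.
  by rewrite ex eW e2 subrr !mulr0 subrr.
have e4 : (be + ep) * (t - 1) - ep * (q * t - 1) = 0.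
  apply: (cancel (q * a * (q * t - 1))); first by rewrite !mulf_neq0.
  transitivity ((t - 1) * (Ly - LW) -
      q * a * (de * ((q - 1) * (t - 1)) + ep * (q * t - 1) ^+ 2)).
    by rewrite /Ly /LW; ring.
  by rewrite ey eW e2 subrr !mulr0 subrr.
have e5 : q * (al + be + de + ep) + ga + q ^+ 2 * t * ep = 0.
  apply: (cancel ((q - 1) * (t - 1))); first by rewrite mulf_neq0.
  transitivity (
     (t - 1) * ((q - 1) * (q * al + ga + q * ep) - q * ep * (q * t - 1)) +
     q * (q - 1) * ((be + ep) * (t - 1) - ep * (q * t - 1)) +
     q * (de * ((q - 1) * (t - 1)) + ep * (q * t - 1) ^+ 2)).
    ring.
  by rewrite e2 e3 e4 !mulr0 !addr0.
have e6 : ga * (q - 1) + q ^+ 2 * t * ep * (q * a - 1) = 0.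
  transitivity ((q * a - 1) * (q * (al + be + de + ep) + ga + q ^+ 2 * t * ep) -
      q * LW); first by rewrite /LW; ring.
  by rewrite e5 eW !mulr0 subrr.
have ep0 : ep = 0.
  apply: (cancel (N - q ^+ 4 * a ^+ 2 * t ^+ 2)); first by rewrite subr_eq0.
  transitivity ((ga * (q * a * t * (q - 1)) + ep * (N - q ^+ 3 * a * t ^+ 2)) -
     q * a * t * (ga * (q - 1) + q ^+ 2 * t * ep * (q * a - 1))); first by ring.
  by rewrite e1 e6 mulr0 subrr.
have ga0 : ga = 0.
  by apply: (cancel (q - 1)) => //; move: e6; rewrite ep0 mulr0 mul0r addr0 mulrC.
have de0 : de = 0.
  apply: (cancel ((q - 1) * (t - 1))); first by rewrite mulf_neq0.
  by move: e2; rewrite ep0 mul0r addr0 mulrC.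
have be0 : be = 0.
  by apply: (cancel (t - 1)) => //; move: e4; rewrite ep0 mul0r subr0 addr0 mulrC.
split=> //; apply: (cancel ((q - 1) * q)); first by rewrite mulf_neq0.
by move: e3; rewrite ep0 ga0 !mulr0 mul0r subr0 !addr0 mulrA.
Qed.

Lemma free4 (K : fieldType) (E : vectType K) (u1 u2 u3 u4 : E) :
    (forall a b c d, a *: u1 + b *: u2 + c *: u3 + d *: u4 = 0 ->
       [/\ a = 0, b = 0, c = 0 & d = 0]) ->
  free [:: u1; u2; u3; u4].
Proof.
move=> indep; apply: (introT (@freeP _ _ _ [tuple u1; u2; u3; u4])) => f.
rewrite !big_ord_recl big_ord0 addr0 /= !addrA => /indep[f0 f1 f2 f3] i.
case: (unliftP ord0 i) => [{}i ->|-> //].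
case: (unliftP ord0 i) => [{}i ->|-> //].
case: (unliftP ord0 i) => [{}i ->|-> //].
by rewrite (ord1 i).
Qed.

Section Independence.
Variables (F : finFieldType) (V : vectType F) (R : realType) (E : vectType R).
Variables (ip : {dot E for idfun}) (h : subspace V 1 -> E).
Hypothesis hrep : spherical_rep h ip.
Local Notation qn := (qint R #|F|).
Local Notation Q := (#|F|%:R : R).

Lemma ip_sum_hat k (Z : {set subspace V k}) (u : {vspace V}) d :
    (forall z, z \in Z -> \dim (val z :&: u) = d) ->
  ip (\sum_(z in Z) hat h (val z)) (hat h u) =
    #|Z|%:R * (qn (\dim {:V}) * qn d - qn k * qn (\dim u)).
Proof.
move=> dZ; rewrite ip_suml mulr_natl -sumr_const; apply: eq_bigr => z zZ.
by rewrite (ip_hat hrep) dZ // dim_subspace.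
Qed.

Lemma free_hat_Bvec_Cvec k w (x y : subspace V k) :
    \dim (val x :&: val y) = w -> (0 < w)%N -> (w + 1 < k)%N ->
    (2 * k < \dim {:V})%N ->
  free [:: hat h (val x); hat h (val y); Bvec h x y; Cvec h x y].
Proof.
move=> dW w_gt0 w_lt n_gt.
have q_gt1 : (1 < #|F|)%N by apply: finNzRing_gt1.
have k_gt0 : (0 < k)%N by move: w_lt; clear; lia.
have dS : \dim (val x + val y) = (2 * k - w)%N.
  have := dimv_sum_cap (val x) (val y); rewrite !dim_subspace dW.
  by move: (\dim _) => a; clear; lia.
have dimB z : z \in Bset x y -> [/\ \dim (val z :&: (val x :&: val y)) = (w - 1)%N,
    \dim (val z :&: val x) = (k - 1)%N, \dim (val z :&: val y) = (w - 1)%N &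
    \dim (val z :&: (val x + val y)) = (k - 1)%N].
  rewrite mem_Bset => /andP[xz /eqP zy]; have [-> ->] := dims_farther xz zy.
  by rewrite (capvC (val z) (val x)) (eqP xz) -dW -zy subn1.
have dimC z : z \in Cset x y -> [/\ \dim (val z :&: (val x :&: val y)) = w,
    \dim (val z :&: val x) = (k - 1)%N, \dim (val z :&: val y) = w.+1 &
    \dim (val z :&: (val x + val y)) = k].
  rewrite mem_Cset ?dW //; last by move: w_lt; clear; lia.
  move=> /andP[xz /eqP zy].
  have [-> ->] := dims_closer xz k_gt0 (etrans zy (congr1 S (esym dW))).
  by rewrite dW (capvC (val z) (val x)) (eqP xz) zy.
have B_neq0 : #|Bset x y|%:R != 0 :> R.
  rewrite pnatr_eq0 -lt0n; apply/card_gt0P.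
  have [||z xz zy] := @exists_neighbour_farther _ _ _ x y; rewrite ?dS ?dW //.
    by move: n_gt; clear; lia.
  by exists z; rewrite mem_Bset xz -zy eqxx.
have lt_wk : (w < k)%N by move: w_lt; clear; lia.
have C_neq0 : #|Cset x y|%:R != 0 :> R.
  rewrite pnatr_eq0 -lt0n; apply/card_gt0P.
  have [|z xz zy] := @exists_neighbour_closer _ _ _ x y; first by rewrite dW.
  by exists z; rewrite mem_Cset ?dW // xz zy dW eqxx.
apply: free4 => al be ga0 de0 rel0.
pose ga := ga0 * #|Bset x y|%:R; pose de := de0 * #|Cset x y|%:R.
have N_neq0 : qn (\dim {:V}) != 0 by rewrite qn_neq0 //; move: n_gt; clear; lia.
(* ep is the constant that turns inner products into sums over points. *)
pose ep := - (qn k * (al + be + ga + de)) / qn (\dim {:V}).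
have q1 : Q - 1 != 0 by rewrite subr_eq0 pnatr_eq1 gtn_eqF.
have row u dX dY dB dC :
    \dim (val x :&: u) = dX -> \dim (val y :&: u) = dY ->
    (forall z, z \in Bset x y -> \dim (val z :&: u) = dB) ->
    (forall z, z \in Cset x y -> \dim (val z :&: u) = dC) ->
  al * (Q ^+ dX - 1) + be * (Q ^+ dY - 1) + ga * (Q ^+ dB - 1) +
    de * (Q ^+ dC - 1) + ep * (Q ^+ (\dim u) - 1) = 0.
  move=> eX eY eB eC.
  have := congr1 (fun v => ip v (hat h u)) rel0.
  rewrite linear0l !ipDl !ipZl !(ip_hat hrep) (ip_sum_hat eB) (ip_sum_hat eC).
  rewrite eX eY !dim_subspace => rel_u.
  have qnE m : Q ^+ m - 1 = qn m * (Q - 1) by rewrite /qint divfK.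
  rewrite !qnE /ep.
  apply: (mulfI N_neq0); rewrite mulr0 -[RHS](mul0r (Q - 1)) -rel_u /ga /de.
  by field.
have eW := row (val x :&: val y)%VS w w (w - 1)%N w.
have ex := row (val x) k w (k - 1)%N (k - 1)%N.
have ey := row (val y) w k (w - 1)%N w.+1.
have eS := row (val x + val y)%VS k k (k - 1)%N k.
have eV : (al + be + ga + de) * (Q ^+ k - 1) + ep * (Q ^+ (\dim {:V}) - 1) = 0.
  have capV (z : subspace V k) : \dim (val z :&: fullv) = k.
    by rewrite capvf dim_subspace.
  rewrite -[RHS](row fullv k k k k) //; ring.
(* All powers of q in the equations are monomials in q, a and t, as
   w = 1 + (w - 1) and k = 2 + (w - 1) + (k - w - 1). *)
pose a := Q ^+ (w - 1); pose t := Q ^+ (k - w - 1).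
have {}eW := eW _ _ (fun z zB => let: And4 e _ _ _ := dimB z zB in e)
  (fun z zC => let: And4 e _ _ _ := dimC z zC in e).
have {}ex := ex _ _ (fun z zB => let: And4 _ e _ _ := dimB z zB in e)
  (fun z zC => let: And4 _ e _ _ := dimC z zC in e).
have {}ey := ey _ _ (fun z zB => let: And4 _ _ e _ := dimB z zB in e)
  (fun z zC => let: And4 _ _ e _ := dimC z zC in e).
have {}eS := eS _ _ (fun z zB => let: And4 _ _ _ e := dimB z zB in e)
  (fun z zC => let: And4 _ _ _ e := dimC z zC in e).
have pow (m i1 i2 i3 : nat) : m = (i1 + i2 * (w - 1) + i3 * (k - w - 1))%N ->
    Q ^+ m = Q ^+ i1 * a ^+ i2 * t ^+ i3.
  by move->; rewrite !exprD !(mulnC _ (_ - 1)%N) !exprM.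
have Q_inj i j : Q ^+ i = Q ^+ j -> i = j.
  by move=> /eqP; rewrite -!natrX eqr_nat eqn_exp2l // => /eqP.
have Q_neq1 i : (0 < i)%N -> Q ^+ i != 1.
  by move=> i0; apply/eqP => /(Q_inj i 0%N) i00; rewrite i00 in i0.
have Q_neq0 i : Q ^+ i != 0 by rewrite expf_neq0 // pnatr_eq0 -lt0n ltnW.
have powW : Q ^+ w = Q * a.
  by rewrite (pow _ 1 1 0)%N ?mulr1 //; move: w_gt0; clear; lia.
have powk : Q ^+ k = Q ^+ 2 * a * t.
  by rewrite (pow _ 2 1 1)%N //; move: w_gt0 w_lt; clear; lia.
have powk1 : Q ^+ (k - 1) = Q * a * t.
  by rewrite (pow _ 1 1 1)%N //; move: w_gt0 w_lt; clear; lia.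
have powS : Q ^+ (2 * k - w) = Q ^+ 3 * a * t ^+ 2.
  by rewrite (pow _ 3 1 2)%N //; move: w_gt0 w_lt; clear; lia.
have [|||||||||||| al0 be0 gaB0 deC0] := @gram_system_trivial _ Q a t
  (Q ^+ \dim {:V}) al be ga de ep.
- exact: (Q_neq0 1%N).
- exact: (Q_neq1 1%N).
- exact: Q_neq0.
- exact: Q_neq0.
- by apply: Q_neq1; move: w_lt; clear; lia.
- by rewrite -exprS; apply: Q_neq1.
- rewrite -(pow (2 * k) 4 2 2)%N; last by move: w_gt0 w_lt; clear; lia.
  by apply/eqP => /Q_inj nk; move: n_gt; rewrite nk ltnn.
- have <- := eW; first by rewrite dW powW /a; ring.
    by rewrite capvA capvv.
  by rewrite capvC -capvA capvv.
- have <- := ex; first by rewrite dim_subspace powW powk powk1; ring.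
    by rewrite capvv dim_subspace.
  by rewrite capvC.
- have <- := ey; first by rewrite dim_subspace (exprS _ w) powW powk /a; ring.
    by [].
  by rewrite capvv dim_subspace.
- have <- := eS; first by rewrite dS powS powk powk1; ring.
    by rewrite (capv_idPl (addvSl _ _)) dim_subspace.
  by rewrite (capv_idPl (addvSr _ _)) dim_subspace.
- by rewrite -powk.
move/eqP: gaB0; rewrite mulf_eq0 (negPf B_neq0) orbF => /eqP ga00.
move/eqP: deC0; rewrite mulf_eq0 (negPf C_neq0) orbF => /eqP de00.
by split.
Qed.
End Independence.

(** * The basis of the fixed space *)

Theorem theorem11p1 (F : finFieldType) (n k : nat) (hk : (6 <= 2 * k)%N)
    (hn : (2 * k < n)%N) (V : vectType F) (dimV : \dim {:V} = n)
    (R : realType) (E : vectType R) (ip : {dot E for idfun})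
    (dimE : (\dim {:E})%:R = qint R #|F| n%:Z - 1)
    (h : subspace V 1 -> E) (hrep : spherical_rep h ip)
    (act : GL V -> 'End(E)) (hact : induced_action h act)
    (x y : subspace V k)
    (hxy : (1 < grassmann_dist x y < k)%N) :
  basis_of (Fix act (val x) (val y))
    [:: hat h (val x); hat h (val y); Bvec h x y; Cvec h x y].
Proof.
have dimV_gt0 : (0 < \dim {:V})%N by rewrite dimV; move: hn; clear; lia.
move: hxy; rewrite grassmann_distE => /andP[].
have [w dW] : exists w, \dim (val x :&: val y) = w by exists (\dim (val x :&: val y)).
rewrite dW => gt1 lt_k.
have w_gt0 : (0 < w)%N by move: lt_k; clear; lia.
have w_lt : (w + 1 < k)%N by move: gt1; clear; lia.
rewrite basisEfree (free_hat_Bvec_Cvec hrep dW) //=; last by rewrite dimV.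
apply/andP; split; last first.
  exact: leq_trans (dimvS (Fix_sub_span hrep dimV_gt0 hact _ _)) (dim_span _).
apply/span_subvP => v; rewrite !inE => /or4P[] /eqP->.
- by apply: hat_in_Fix => // g; rewrite inE => /andP[/eqP].
- by apply: hat_in_Fix => // g; rewrite inE => /andP[_ /eqP].
- apply: sum_hat_in_Fix => // g z gS.
  by rewrite !mem_Bset !(gl_grassmann_stable _ gS).
- apply: sum_hat_in_Fix => // g z gS.
  by rewrite !mem_Cset ?dW ?(gl_grassmann_stable _ gS) //; move: w_lt; clear; lia.
Qed.
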